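(* Let $f:\mathbb{R}^n\to\mathbb{R}$ be $L$-smooth and $\mu$-strongly convex with $\mu\ge0$ ($\mu=0$ meaning convex), with nonempty set of minimizers $\mathcal{X}^\star$, and let $\mathcal{P}\subseteq\mathbb{R}^{n\times n}$ be a closed convex set with $0\in\mathcal{P}$, $L^{-1}I\in\mathcal{P}$ and $\mathrm{diam}(\mathcal{P})\le D$, $D>0$. For $K\ge1$ run OSGM-H from $x^1\in\mathbb{R}^n\setminus\mathcal{X}^\star$, $P_1\in\mathcal{P}$ with stepsize $\eta=\frac{2D}{(LD+1)\sqrt K}$ for $K$ iterations. Then: (i) if $x^1,\dots,x^K\notin\mathcal{X}^\star$, then $\theta_K^\star:=\min_{P\in\mathcal{P}}\frac1K\sum_{k=1}^Kh_{x^k}(P)\le-\gamma^\star$. (ii) If $\mu>0$, the asymptotic complexity of finding an $\varepsilon$-optimal point is $\mathcal{O}\big(\frac1{2\mu\gamma^\star}\log(1/\varepsilon)\big)$: there is an absolute constant $C>0$ such that for every problem instance (i.e. choice of $f,\mathcal{P},L,\mu,D,x^1,P_1$ and oracle) there is $\varepsilon_0\in(0,1)$ such that for all $\varepsilon\in(0,\varepsilon_0)$ and all integers $K\ge\frac{C}{2\mu\gamma^\star}\log(1/\varepsilon)$, the run with horizon $K$ generates an iterate $x^k$, $1\le k\le K+1$, with $f(x^k)\le f(x^\star)+\varepsilon$. (iii) If $\mu=0$ and $\Delta<\infty$, the asymptotic complexity of finding an $\varepsilon$-optimal point is $\mathcal{O}\big(\frac1{\gamma^\star\varepsilon}\big)$: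 there is a constant $C>0$ depending only on $\Delta$ such that for every problem instance there is $\varepsilon_0\in(0,1)$ such that for all $\varepsilon\in(0,\varepsilon_0)$ and all integers $K\ge\frac{C}{\gamma^\star\varepsilon}$, the run with horizon $K$ generates an iterate $x^k$, $1\le k\le K+1$, with $f(x^k)\le f(x^\star)+\varepsilon$.
   Context: Norms: $\|\cdot\|$ is the Euclidean norm of vectors; $\|\cdot\|_F$ is the Frobenius norm; $\mathrm{diam}(\mathcal{P})=\sup_{P,Q\in\mathcal{P}}\|P-Q\|_F$. Assumptions on $f$: $f$ is twice differentiable; $L$-smooth means $|f(x)-f(y)-\langle\nabla f(y),x-y\rangle|\le\frac L2\|x-y\|^2$ for all $x,y$; $\mu$-strongly convex means $f(x)-f(y)-\langle\nabla f(y),x-y\rangle\ge\frac\mu2\|x-y\|^2$ for all $x,y$. $f(x^\star)=\min f$. $\mathcal{L}_{f(x^1)}=\{x:f(x)\le f(x^1)\}$ and $\Delta:=\max_{x\in\mathcal{L}_{f(x^1)}}\min_{x^\star\in\mathcal{X}^\star}\|x-x^\star\|$. Hypergradient surrogate: for $x\notin\mathcal{X}^\star$, $h_x(P):=\dfrac{f(x-P\nabla f(x))-f(x)}{\|\nabla f(x)\|^2}$, with gradient in $P$: $\nabla h_x(P)=-\dfrac{\nabla f(x-P\nabla f(x))\nabla f(x)^\top}{\|\nabla f(x)\|^2}$. Define $\gamma^\star:=\max_{P\in\mathcal{P}}\inf_{x\in\mathcal{L}_{f(x^1)}\setminus\mathcal{X}^\star}-h_x(P)$. OSGM-H: for $k=1,2,\dots$: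 $x^{k+1}=\mathcal{M}_{P_k}(x^k)$ and $P_{k+1}=\Pi_{\mathcal{P}}[P_k-\eta\nabla h_{x^k}(P_k)]$, where $\Pi_{\mathcal{P}}$ is the orthogonal projection onto $\mathcal{P}$ (Frobenius inner product) and $\mathcal{M}_P:\mathbb{R}^n\to\mathbb{R}^n$ is any monotone descent oracle for the function value gap, i.e. any map with $f(\mathcal{M}_P(x))\le\min\{f(x),f(x-P\nabla f(x))\}$ for all $x$. The algorithm stops if an iterate is a minimizer of $f$. *)

(* Defs.v *)
From mathcomp Require Export all_boot all_order all_algebra.
From mathcomp Require Export all_classical all_reals all_analysis.
Export Order.TTheory GRing.Theory Num.Theory.
Export numFieldNormedType.Exports.

Set Implicit Arguments.
Unset Strict Implicit.
Unset Printing Implicit Defensive.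

Local Open Scope classical_set_scope.
Local Open Scope ring_scope.

(* The library's norm on matrices is the sup norm; it is used here only through
   the (norm-independent) notions of closedness and differentiability. *)
Definition fnorm (R : realType) m n (A : 'M[R]_(m, n)) : R :=
  Num.sqrt (\sum_i \sum_j A i j ^+ 2).

Definition enorm (R : realType) n (x : 'cV[R]_n) : R :=
  Num.sqrt (\sum_i x i 0 ^+ 2).

Definition inner (R : realType) n (x y : 'cV[R]_n) : R :=
  \sum_i x i 0 * y i 0.

Definition diam (R : realType) m n (PP : set 'M[R]_(m, n)) : \bar R :=
  ereal_sup [set (fnorm (A.1 - A.2))%:E | A in PP `*` PP].

Definition is_maximum d (T : porderType d) (S : set T) (m : T) : Prop :=
  S m /\ ubound S m.

Definition is_minimum d (T : porderType d) (S : set T) (m : T) : Prop :=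
  S m /\ lbound S m.

Definition gradient (R : realType) n (f : 'cV[R]_n -> R) (x : 'cV[R]_n) :
  'cV[R]_n := \col_i 'D_(delta_mx i 0) f x.

Definition twice_differentiable (R : realType) n (f : 'cV[R]_n -> R) : Prop :=
  (forall x, differentiable f x) /\ (forall x, differentiable (gradient f) x).

Definition bregman (R : realType) n (f : 'cV[R]_n -> R) (x y : 'cV[R]_n) : R :=
  f x - f y - inner (gradient f y) (x - y).

Definition smooth (R : realType) n (L : R) (f : 'cV[R]_n -> R) : Prop :=
  forall x y, `|bregman f x y| <= L / 2 * enorm (x - y) ^+ 2.

Definition strongly_convex (R : realType) n (mu : R) (f : 'cV[R]_n -> R) : Prop :=
  forall x y, mu / 2 * enorm (x - y) ^+ 2 <= bregman f x y.

Definition minimizers (R : realType) n (f : 'cV[R]_n -> R) : set 'cV[R]_n :=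
  [set x | forall y, f x <= f y].

Definition sublevel (R : realType) n (f : 'cV[R]_n -> R) (x1 : 'cV[R]_n) :
  set 'cV[R]_n := [set x | f x <= f x1].

(* Extended-real valued, since the distance to the minimizers may be unbounded
   on the sublevel set. *)
Definition Delta (R : realType) n (f : 'cV[R]_n -> R) (x1 : 'cV[R]_n) : \bar R :=
  ereal_sup [set ereal_inf [set (enorm (x - z))%:E | z in minimizers f]
            | x in sublevel f x1].

Definition surrogate (R : realType) n (f : 'cV[R]_n -> R) (x : 'cV[R]_n)
    (P : 'M[R]_n) : R :=
  (f (x - P *m gradient f x) - f x) / enorm (gradient f x) ^+ 2.

Definition surrogate_grad (R : realType) n (f : 'cV[R]_n -> R) (x : 'cV[R]_n)
    (P : 'M[R]_n) : 'M[R]_n :=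
  - ((enorm (gradient f x) ^+ 2)^-1 *:
     (gradient f (x - P *m gradient f x) *m (gradient f x)^T)).

Definition worst_decrease (R : realType) n (f : 'cV[R]_n -> R) (x1 : 'cV[R]_n)
    (P : 'M[R]_n) : \bar R :=
  ereal_inf [set (- surrogate f x P)%:E | x in sublevel f x1 `\` minimizers f].

(* The value of the maximum, written as a supremum so that it is total; that it
   is finite and attained is asserted in the theorem. *)
Definition gamma_star (R : realType) n (f : 'cV[R]_n -> R) (PP : set 'M[R]_n)
    (x1 : 'cV[R]_n) : R :=
  fine (ereal_sup [set worst_decrease f x1 P | P in PP]).

Definition fproj (R : realType) n (PP : set 'M[R]_n) (A : 'M[R]_n) : 'M[R]_n :=
  xget 0 [set B | PP B /\ forall C, PP C -> fnorm (A - B) <= fnorm (A - C)].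

Definition monotone_oracle (R : realType) n (f : 'cV[R]_n -> R)
    (PP : set 'M[R]_n) (M : 'M[R]_n -> 'cV[R]_n -> 'cV[R]_n) : Prop :=
  forall P, PP P -> forall x,
    f (M P x) <= Num.min (f x) (f (x - P *m gradient f x)).

(* Stopping is encoded by freezing the state: after a minimizer is reached no
   point other than that minimizer is ever produced. *)
Definition osgm_step (R : realType) n (f : 'cV[R]_n -> R) (PP : set 'M[R]_n)
    (M : 'M[R]_n -> 'cV[R]_n -> 'cV[R]_n) (eta : R)
    (s : 'cV[R]_n * 'M[R]_n) : 'cV[R]_n * 'M[R]_n :=
  if s.1 \in minimizers f then s
  else (M s.2 s.1, fproj PP (s.2 - eta *: surrogate_grad f s.1 s.2)).

Definition osgm_eta (R : realType) (L D : R) (K : nat) : R :=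
  2 * D / ((L * D + 1) * Num.sqrt K%:R).

(* Iterates are numbered from 1; the step size depends on the horizon K. *)
Definition osgm_x (R : realType) n (f : 'cV[R]_n -> R) (PP : set 'M[R]_n)
    (L D : R) (x1 : 'cV[R]_n) (P1 : 'M[R]_n)
    (M : 'M[R]_n -> 'cV[R]_n -> 'cV[R]_n) (K k : nat) : 'cV[R]_n :=
  (iter k.-1 (osgm_step f PP M (osgm_eta L D K)) (x1, P1)).1.

Record osgm_instance (R : realType) n (f : 'cV[R]_n -> R) (PP : set 'M[R]_n)
    (L mu D : R) (x1 : 'cV[R]_n) (P1 : 'M[R]_n)
    (M : 'M[R]_n -> 'cV[R]_n -> 'cV[R]_n) : Prop := OsgmInstance {
  inst_diff : twice_differentiable f;
  inst_L : 0 < L;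
  inst_mu : 0 <= mu;
  inst_smooth : smooth L f;
  inst_convex : strongly_convex mu f;
  inst_min : minimizers f !=set0;
  inst_closed : closed PP;
  inst_PP_convex : @convex_set R 'M[R]_n PP;
  inst_PP0 : PP 0;
  inst_PPL : PP (L^-1)%:M;
  inst_D : 0 < D;
  inst_diam : (diam PP <= D%:E)%E;
  inst_x1 : ~ minimizers f x1;
  inst_P1 : PP P1;
  inst_oracle : monotone_oracle f PP M
}.

(* Main.v *)
(* The surrogates h_x are convex in P, and their gradients are bounded on the
   bounded set PP because the gradient of f is L-Lipschitz. Projected online
   gradient descent therefore has regret O(sqrt K) against every P in PP, in
   particular against the maximizer defining gamma^*, whose surrogates are all
   at most -gamma^*. Hence the total progress sum_k max(0, -h_{x^k}(P_k)) is at
   least K gamma^* / 2 once K exceeds a constant of the instance. The oracle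
   gives r_{k+1} <= r_k - a_k |grad f(x^k)|^2 for the gaps r_k and the progress
   a_k; bounding the gradient below by 2 mu r_k (Polyak-Lojasiewicz), resp. by
   (r_k / Delta)^2, turns this into r_{K+1} <= r_1 exp(- mu gamma^* K), resp.
   1 / r_{K+1} >= K gamma^* / (2 Delta^2). *)

From mathcomp Require Import ring lra.
Require Import Defs.

Set Implicit Arguments.
Unset Strict Implicit.
Unset Printing Implicit Defensive.

Local Open Scope classical_set_scope.
Local Open Scope ring_scope.

(** * Frobenius inner product and its inequalities *)

Section frobenius.
Context {R : realType}.

(** On one-column matrices this is the dot product, so one calculus serves both vectors and
    matrices. *)
Definition mdot m n (A B : 'M[R]_(m, n)) : R := \sum_i \sum_j A i j * B i j.

Section mdot.
Context {m n : nat}.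
Implicit Types A B C : 'M[R]_(m, n).

Lemma mdotC A B : mdot A B = mdot B A.
Proof. by apply: eq_bigr => i _; apply: eq_bigr => j _; rewrite mulrC. Qed.

Lemma mdotDl A B C : mdot (A + B) C = mdot A C + mdot B C.
Proof.
rewrite /mdot -big_split; apply: eq_bigr => i _; rewrite -big_split.
by apply: eq_bigr => j _; rewrite mxE mulrDl.
Qed.

Lemma mdotZl a A B : mdot (a *: A) B = a * mdot A B.
Proof.
rewrite /mdot mulr_sumr; apply: eq_bigr => i _; rewrite mulr_sumr.
by apply: eq_bigr => j _; rewrite mxE mulrA.
Qed.

Lemma mdot0l A : mdot 0 A = 0.
Proof. by rewrite -(scale0r A) mdotZl mul0r. Qed.

Lemma mdotNl A B : mdot (- A) B = - mdot A B.
Proof. by rewrite -scaleN1r mdotZl mulN1r. Qed.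

Lemma mdotDr A B C : mdot C (A + B) = mdot C A + mdot C B.
Proof. by rewrite !(mdotC C) mdotDl. Qed.

Lemma mdotZr a A B : mdot A (a *: B) = a * mdot A B.
Proof. by rewrite !(mdotC A) mdotZl. Qed.

Lemma mdotNr A B : mdot A (- B) = - mdot A B.
Proof. by rewrite !(mdotC A) mdotNl. Qed.

Definition mdotE := (mdotDl, mdotDr, mdotNl, mdotNr, mdotZl, mdotZr).

Lemma mdot_ge0 A : 0 <= mdot A A.
Proof. by apply: sumr_ge0 => i _; apply: sumr_ge0 => j _; rewrite -expr2 sqr_ge0. Qed.

Lemma mdot_ge_sqr A i j : A i j ^+ 2 <= mdot A A.
Proof.
rewrite /mdot (bigD1 i) //= (bigD1 j) //= -expr2 -addrA lerDl.
rewrite addr_ge0 //; first by apply: sumr_ge0 => k _; rewrite -expr2 sqr_ge0.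
by apply: sumr_ge0 => k _; apply: sumr_ge0 => l _; rewrite -expr2 sqr_ge0.
Qed.

Lemma mdot_eq0 A : mdot A A = 0 -> A = 0.
Proof.
move=> A0; apply/matrixP => i j; rewrite mxE; apply/eqP.
by rewrite -sqrf_eq0 eq_le sqr_ge0 andbT -A0 mdot_ge_sqr.
Qed.

Lemma mdot_CauchySchwarz A B : mdot A B ^+ 2 <= mdot A A * mdot B B.
Proof.
have [B0|B0] := eqVneq (mdot B B) 0.
  have -> : B = 0 by exact: mdot_eq0.
  by rewrite mdotC !mdot0l mulr0 expr0n.
(* The component of [A] orthogonal to [B], scaled by [mdot B B] to avoid a division. *)
have := mdot_ge0 (mdot B B *: A - mdot A B *: B).
rewrite !mdotE (mdotC B A) => h.
have Bp : 0 < mdot B B by rewrite lt_def B0 mdot_ge0.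
rewrite -subr_ge0 -(pmulr_rge0 _ Bp); apply: le_trans h _.
by rewrite le_eqVlt; apply/orP; left; apply/eqP; ring.
Qed.

Lemma fnorm_sqr A : fnorm A ^+ 2 = mdot A A.
Proof.
rewrite /fnorm sqr_sqrtr; first by apply: eq_bigr => i _; apply: eq_bigr.
by apply: sumr_ge0 => i _; apply: sumr_ge0 => j _; rewrite sqr_ge0.
Qed.

Lemma fnormE A : fnorm A = Num.sqrt (mdot A A).
Proof. by rewrite -fnorm_sqr sqrtr_sqr ger0_norm // sqrtr_ge0. Qed.

End mdot.

Lemma innerE n (x y : 'cV[R]_n) : inner x y = mdot x y.
Proof. by apply: eq_bigr => i _; rewrite big_ord1. Qed.

Lemma enorm_sqr n (x : 'cV[R]_n) : enorm x ^+ 2 = mdot x x.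
Proof.
rewrite -fnorm_sqr; congr (Num.sqrt _ ^+ 2).
by apply: eq_bigr => i _; rewrite big_ord1.
Qed.

(** Cauchy-Schwarz on each row of [A]: the Frobenius norm dominates the operator norm. *)
Lemma mdot_mulmx_le m n (A : 'M[R]_(m, n)) (x : 'cV[R]_n) :
  mdot (A *m x) (A *m x) <= mdot A A * mdot x x.
Proof.
rewrite {1 2}/mdot mulr_suml; apply: ler_sum => i _; rewrite big_ord1.
suff -> : (A *m x) i 0 = mdot (row i A)^T x.
  rewrite -expr2 (le_trans (mdot_CauchySchwarz _ _)) //.
  rewrite le_eqVlt; apply/orP; left; apply/eqP; congr (_ * _).
  by apply: eq_bigr => j _; rewrite big_ord1 !mxE.
by rewrite mxE; apply: eq_bigr => j _; rewrite big_ord1 !mxE.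
Qed.

Lemma mdot_outer m n (u : 'cV[R]_m) (v : 'cV[R]_n) (A : 'M[R]_(m, n)) :
  mdot (u *m v^T) A = mdot u (A *m v).
Proof.
apply: eq_bigr => i _; rewrite big_ord1 mxE mulr_sumr.
by apply: eq_bigr => j _; rewrite !mxE big_ord1 !mxE; ring.
Qed.

Lemma mdot_outer_outer m n (u : 'cV[R]_m) (v : 'cV[R]_n) :
  mdot (u *m v^T) (u *m v^T) = mdot u u * mdot v v.
Proof.
rewrite mdot_outer -mulmxA.
suff -> : v^T *m v = (mdot v v)%:M by rewrite mul_mx_scalar mdotZr mulrC.
apply/matrixP => i j; rewrite !ord1 !mxE eqxx mulr1n.
by apply: eq_bigr => k _; rewrite big_ord1 mxE.
Qed.

End frobenius.

(** * Continuity, compactness and attained minima for matrix arguments *)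

Section compactness.
Context {R : realType}.

Lemma continuous_mx m n (T : topologicalType) (g : T -> 'M[R]_(m, n)) :
  (forall i j, continuous (fun x => g x i j)) -> continuous g.
Proof.
move=> gc x; apply/cvg_ballP => e e0.
have H : \forall y \near x, forall i j, ball (g x i j) e (g y i j).
  apply: filter_forall => i; apply: filter_forall => j.
  have /cvg_ballP/(_ e e0) := gc i j x; exact.
by near=> y; split => //; near: y.
Unshelve. all: by end_near. Qed.

Lemma continuous_sum (T : topologicalType) (I : Type) (r : seq I) (F : I -> T -> R) :
  (forall i, continuous (F i)) -> continuous (fun x => \sum_(i <- r) F i x).
Proof.
move=> Fc; elim: r => [|i r IH].
  by under eq_fun do rewrite big_nil; move=> x; exact: cvg_cst.
under eq_fun do rewrite big_cons; move=> x.
by apply: cvgD; [exact: Fc | exact: IH].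
Qed.

Lemma continuous_mdot m n (T : topologicalType) (g h : T -> 'M[R]_(m, n)) :
  continuous g -> continuous h -> continuous (fun x => mdot (g x) (h x)).
Proof.
move=> gc hc; apply: continuous_sum => i; apply: continuous_sum => j x.
apply: cvgM.
  exact: (continuous_comp (gc x) (@coord_continuous R m n i j (g x))).
exact: (continuous_comp (hc x) (@coord_continuous R m n i j (h x))).
Qed.

Lemma continuous_mulmxl m n p (T : topologicalType) (g : T -> 'M[R]_(m, n))
    (B : 'M[R]_(n, p)) :
  continuous g -> continuous (fun x => g x *m B).
Proof.
move=> gc; apply: continuous_mx => i j.
under eq_fun do rewrite mxE.
apply: continuous_sum => k x; apply: cvgM; last exact: cvg_cst.
exact: (continuous_comp (gc x) (@coord_continuous R m n i k (g x))).
Qed.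

(** Heine-Borel for row vectors, transported along the continuous bijection [vec_mx]; the Frobenius
    bound controls every entry, hence the sup norm. *)
Lemma bounded_closed_compact_mx m n (A : set 'M[R]_(m, n)) (b : R) :
  (forall P, A P -> mdot P P <= b ^+ 2) -> closed A -> compact A.
Proof.
move=> Ab Ac.
have vc : continuous (@vec_mx R m n).
  apply: continuous_mx => i j.
  have -> : (fun v : 'rV[R]_(m * n) => vec_mx v i j) =
            (fun v => v 0 (mxvec_index i j)).
    by apply/funext => v; rewrite mxE.
  exact: coord_continuous.
have -> : A = vec_mx @` (vec_mx @^-1` A).
  apply/seteqP; split => [P AP|_ [v Av <-] //].
  by exists (mxvec P); rewrite /= ?mxvecK.
apply: continuous_compact; first exact: continuous_subspaceT.
apply: bounded_closed_compact; last first.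
  by apply: preimage_closed => // v _; exact: vc.
exists `|b|; split; first by rewrite num_real.
move=> x bx v Av; rewrite /Num.norm /= mx_normrE; apply/bigmax_leP; split.
  by rewrite (le_trans _ (ltW bx)).
move=> [i k] _ /=; rewrite (le_trans _ (ltW bx)) // ord1.
rewrite -ler_sqr ?nnegrE // !real_normK ?num_real //.
case/mxvec_indexP: k => p q.
rewrite (le_trans _ (Ab _ Av)) //.
have -> : v 0 (mxvec_index p q) = vec_mx v p q by rewrite mxE.
exact: mdot_ge_sqr.
Qed.

Lemma compact_argmin (T : topologicalType) (A : set T) (g : T -> R) :
  A !=set0 -> compact A -> continuous g ->
  exists2 c, A c & forall t, A t -> g c <= g t.
Proof.
move=> A0 Ac gc.
have [c /set_mem cA cm] := compact_EVT_min A0 Ac (continuous_subspaceT gc).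
by exists c => // t At; apply: cm; exact: mem_set.
Qed.

End compactness.

(** * Orthogonal projection onto a compact convex set *)

Section projection.
Context {R : realType} {n : nat}.
Variable PP : set 'M[R]_n.
Hypotheses (PPconv : @convex_set R 'M[R]_n PP) (PPcomp : compact PP).
Hypothesis PP0 : PP !=set0.

Lemma convex_set_segment (P Q : 'M[R]_n) (t : R) :
  PP P -> PP Q -> 0 <= t -> t <= 1 -> PP (t *: P + (1 - t) *: Q).
Proof.
move=> p q t0 t1.
by have := PPconv (Itv01 t0 t1) (mem_set p) (mem_set q); rewrite inE.
Qed.

(** The squared distance to [A] attains its minimum on the nonempty compact [PP], so [xget] does
    pick a nearest point. *)
Lemma fproj_min (A : 'M[R]_n) :
  PP (fproj PP A) /\
  forall C, PP C -> fnorm (A - fproj PP A) <= fnorm (A - C).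
Proof.
apply: (@xgetPex _ 0 [set B | PP B /\ forall C, PP C -> fnorm (A - B) <= fnorm (A - C)]).
have Ac : continuous (fun B : 'M[R]_n => A - B).
  by move=> x; apply: continuousB; [exact: cst_continuous | exact: cvg_id].
have [B PB Bmin] := compact_argmin PP0 PPcomp (continuous_mdot Ac Ac).
by exists B; split => // C PC; rewrite !fnormE ler_wsqrtr // Bmin.
Qed.

Lemma fproj_in (A : 'M[R]_n) : PP (fproj PP A).
Proof. by case: (fproj_min A). Qed.

Lemma fproj_obtuse (A C : 'M[R]_n) : PP C ->
  mdot (A - fproj PP A) (C - fproj PP A) <= 0.
Proof.
move=> PC; have [PB Bmin] := fproj_min A; set B := fproj PP A in PB Bmin *.
set u := A - B; set v := C - B; rewrite leNgt; apply/negP => uv.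
(* If the angle at [B] were acute, moving from [B] towards [C] by this [t] in (0, 1] would bring the
   point closer to [A]: [t * mdot v v] is below [2 * mdot u v]. The denominator is positive even
   when [mdot v v] is 0. *)
have vv := mdot_ge0 v; set t := mdot u v / (mdot u v + mdot v v).
have d0 : 0 < mdot u v + mdot v v by lra.
have t0 : 0 < t by rewrite divr_gt0.
have t1 : t <= 1 by rewrite ler_pdivrMr //; lra.
have := Bmin _ (convex_set_segment PC PB (ltW t0) t1).
have -> : A - (t *: C + (1 - t) *: B) = u - t *: v.
  by apply/matrixP => i j; rewrite !mxE; ring.
rewrite -ler_sqr ?nnegrE ?sqrtr_ge0 // !fnorm_sqr -/u; clearbody u v.
rewrite !mdotE (mdotC v u) => h.
have {h} : 0 <= t * (t * mdot v v - 2 * mdot u v) by lra.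
rewrite pmulr_rge0 // => h.
have e : t * mdot v v = mdot u v - t * mdot u v.
  by rewrite /t; field; rewrite gt_eqF.
have : 0 < t * mdot u v by rewrite mulr_gt0.
lra.
Qed.

(** With [B] the projection, |A - C|^2 = |A - B|^2 - 2 <A - B, C - B> + |C - B|^2, and the obtuse
    angle makes the cross term nonnegative. *)
Lemma fproj_contract (A C : 'M[R]_n) : PP C ->
  mdot (fproj PP A - C) (fproj PP A - C) <= mdot (A - C) (A - C).
Proof.
move=> /(fproj_obtuse A); set B := fproj PP A => h.
have := mdot_ge0 (A - B).
have -> : A - C = (A - B) - (C - B) by apply/matrixP => i j; rewrite !mxE; ring.
have -> : B - C = - (C - B) by rewrite opprB.
move: (A - B) (C - B) h => u v; rewrite !mdotE (mdotC v u); lra.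
Qed.

End projection.

(** * Gradient inequalities for smooth convex functions and their surrogates *)

Section smooth_convex.
Context {R : realType} {n : nat}.
Variables (f : 'cV[R]_n -> R) (L : R).
Hypotheses (L0 : 0 < L) (fL : smooth L f).
Hypothesis fconv : forall x y, 0 <= bregman f x y.
Implicit Types x y z : 'cV[R]_n.
Notation g := (gradient f).

Lemma smooth_upper x y : bregman f x y <= L / 2 * mdot (x - y) (x - y).
Proof. by rewrite -enorm_sqr (le_trans (ler_norm _)). Qed.

(* The function [y |-> bregman f y x] is convex, [L]-smooth and minimal at [x],
   so a gradient step from [y] cannot bring it below [0]. *)
Lemma gradient_sub_bregman x y :
  mdot (g y - g x) (g y - g x) <= 2 * L * bregman f y x.
Proof.
set d := g y - g x; pose w := y - L^-1 *: d.
have := smooth_upper w y; have := fconv w x.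
rewrite /bregman !innerE.
have -> : w - y = - (L^-1 *: d) by apply/matrixP => i j; rewrite !mxE; ring.
have -> : w - x = (y - x) - L^-1 *: d by apply/matrixP => i j; rewrite !mxE; ring.
have -> : g y = d + g x by rewrite subrK.
clearbody d; rewrite !mdotE => h1 h2.
have h3 : L * L^-1 = 1 by rewrite divff // gt_eqF.
set dd := mdot d d in h2 *; set r := L^-1 in h1 h2 h3.
have e : L / 2 * - - (r * (r * dd)) = (L * r) * r * dd / 2 by ring.
rewrite e h3 mul1r in h2.
have h4 : r * dd / 2 <= f y - f x - (mdot (g x) y - mdot (g x) x) by lra.
have := ler_wpM2l (ltW L0) h4.
have -> : L * (r * dd / 2) = (L * r) * dd / 2 by ring.
rewrite h3 mul1r; lra.
Qed.

(** Smoothness is given as a quadratic bound on [bregman]; inserting it into the previous estimate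
    turns it into a Lipschitz bound on the gradient. *)
Lemma gradient_lipschitz x y :
  mdot (g y - g x) (g y - g x) <= L ^+ 2 * mdot (y - x) (y - x).
Proof.
apply: le_trans (gradient_sub_bregman x y) _.
have := ler_wpM2l (ltW L0) (smooth_upper y x); lra.
Qed.

Lemma gradient_step x :
  f (x - L^-1 *: g x) - f x <= - (2 * L)^-1 * mdot (g x) (g x).
Proof.
have := smooth_upper (x - L^-1 *: g x) x; rewrite /bregman innerE.
have -> : x - L^-1 *: g x - x = - (L^-1 *: g x).
  by apply/matrixP => i j; rewrite !mxE; ring.
rewrite !mdotE.
have -> : L / 2 * - - (L^-1 * (L^-1 * mdot (g x) (g x))) =
   L^-1 * mdot (g x) (g x) / 2 by field; rewrite gt_eqF.
have -> : (2 * L)^-1 = L^-1 / 2 by field; rewrite gt_eqF.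
lra.
Qed.

(** By convexity a point with zero gradient is a minimizer. This makes the division in the surrogate
    meaningful along the run. *)
Lemma gradient_neq0 x : ~ minimizers f x -> 0 < mdot (g x) (g x).
Proof.
move=> xmin; rewrite lt_def mdot_ge0 andbT; apply/negP => /eqP /mdot_eq0 g0.
apply: xmin => y; have := fconv y x.
by rewrite /bregman innerE g0 mdot0l subr0 subr_ge0.
Qed.

(** Convexity gives f x - f z <= <g x, x - z>; then Cauchy-Schwarz. It bounds the gradient below
    once the distance to the minimizers is bounded. *)
Lemma convex_gap x z : (forall y, f z <= f y) ->
  (f x - f z) ^+ 2 <= mdot (g x) (g x) * mdot (x - z) (x - z).
Proof.
move=> zmin; apply: le_trans (mdot_CauchySchwarz _ _).
rewrite ler_sqr ?nnegrE.
- have := fconv z x; rewrite /bregman innerE -(opprB x z) mdotNr; lra.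
- by rewrite subr_ge0.
- have := fconv z x; have := zmin x; rewrite /bregman innerE -(opprB x z) mdotNr; lra.
Qed.

Lemma polyak_lojasiewicz mu x z : 0 < mu -> strongly_convex mu f ->
  2 * mu * (f x - f z) <= mdot (g x) (g x).
Proof.
move=> mu0 /(_ z x); rewrite /bregman innerE enorm_sqr => h.
(* Completing the square: this amounts to minimizing the strong convexity lower bound over the
   displacement [z - x]. *)
have := mdot_ge0 (g x + mu *: (z - x)).
have := ler_wpM2l (ltW mu0) h; rewrite mulrA.
move: (z - x) => v; rewrite !mdotE (mdotC v (g x)).
lra.
Qed.

Lemma surrogateE x P : surrogate f x P = (f (x - P *m g x) - f x) / mdot (g x) (g x).
Proof. by rewrite /surrogate enorm_sqr. Qed.

(** As a function of [P] the surrogate is the convex [f] after an affine map, up to a constant and a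
    positive factor, and so lies above its tangents. *)
Lemma surrogate_subgradient x P Q : ~ minimizers f x ->
  mdot (surrogate_grad f x Q) (P - Q) <= surrogate f x P - surrogate f x Q.
Proof.
move=> /gradient_neq0 N0.
rewrite !surrogateE /surrogate_grad enorm_sqr mdotNl mdotZl mdot_outer.
have := fconv (x - P *m g x) (x - Q *m g x); rewrite /bregman innerE.
have -> : x - P *m g x - (x - Q *m g x) = - ((P - Q) *m g x).
  by rewrite mulmxBl; apply/matrixP => i j; rewrite !mxE; ring.
rewrite mdotNr -mulrBl mulrC -mulNr => h.
rewrite ler_pM2r ?invr_gt0 //; lra.
Qed.

Lemma surrogate_grad_bound x P : ~ minimizers f x ->
  mdot (surrogate_grad f x P) (surrogate_grad f x P) <=
  2 * (1 + L ^+ 2 * mdot P P).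
Proof.
move=> /gradient_neq0 N0.
rewrite /surrogate_grad enorm_sqr !mdotE mdot_outer_outer opprK.
set N := mdot (g x) (g x) in N0 *; set u := g (x - P *m g x).
have -> : N^-1 * (N^-1 * (mdot u u * N)) = mdot u u / N.
  by field; rewrite gt_eqF.
rewrite ler_pdivrMr //.
have := gradient_lipschitz x (x - P *m g x); rewrite -/u.
have -> : x - P *m g x - x = - (P *m g x) by apply/matrixP => i j; rewrite !mxE; ring.
have := ler_wpM2l (sqr_ge0 L) (mdot_mulmx_le P (g x)); rewrite -/N.
(* This yields |u|^2 <= 2 |u - g x|^2 + 2 |g x|^2, the source of the factor 2. *)
have := mdot_ge0 ((u - g x) - g x).
rewrite !mdotE !opprK (mdotC (g x) u) -/N; lra.
Qed.

Lemma surrogate_scalar x : ~ minimizers f x ->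
  surrogate f x (L^-1)%:M <= - (2 * L)^-1.
Proof.
move=> /gradient_neq0 N0; rewrite surrogateE mul_scalar_mx ler_pdivrMr //.
exact: gradient_step.
Qed.

Lemma continuous_surrogate x : continuous f -> continuous (surrogate f x).
Proof.
move=> fc.
have -> : surrogate f x = fun P => (f (x - P *m g x) - f x) / mdot (g x) (g x).
  by apply/funext => P; rewrite surrogateE.
have c1 : continuous (fun P : 'M[R]_n => x - P *m g x).
  move=> P; apply: (@continuousB R 'cV[R]_n 'M[R]_n (cst x) (mulmx^~ (g x))).
    exact: cst_continuous.
  exact: (@continuous_mulmxl R n n 1 _ id (g x) (fun P => cvg_id) P).
have c2 : continuous (fun P : 'M[R]_n => f (x - P *m g x)).
  by move=> P; apply: (continuous_comp (c1 P)); exact: fc.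
move=> P; apply: (@continuousM R 'M[R]_n (fun P => f (x - P *m g x) - f x) (cst _)).
  apply: (@continuousB R R^o 'M[R]_n (fun P => f (x - P *m g x)) (cst _)).
    exact: c2.
  exact: cst_continuous.
exact: cst_continuous.
Qed.

End smooth_convex.

(** * Scalar recurrences behind the linear and the 1/K rates *)

Section recurrences.
Context {R : realType}.
Implicit Types (r a : nat -> R) (c : R) (K : nat).

(** Each step multiplies the gap by at most 1 - c a_k <= exp(- c a_k). *)
Lemma linear_recurrence r a c K :
  (forall k, (k < K)%N -> 0 <= r k) ->
  (forall k, (k < K)%N -> r k.+1 <= r k - c * a k * r k) ->
  r K <= r 0%N * expR (- (c * \sum_(k < K) a k)).
Proof.
elim: K => [_ _|K IH r0 rS].
  by rewrite big_ord0 mulr0 oppr0 expR0 mulr1.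
have {}IH := IH (fun k kK => r0 k (ltnW kK)) (fun k kK => rS k (ltnW kK)).
rewrite big_ord_recr /= mulrDr opprD expRD mulrA.
apply: (@le_trans _ _ (r K * expR (- (c * a K)))).
  apply: le_trans (rS K (ltnSn K)) _.
  have := ler_wpM2l (r0 K (ltnSn K)) (expR_ge1Dx (- (c * a K))); lra.
by rewrite ler_wpM2r // expR_ge0.
Qed.

(** The reciprocal 1 / r_k grows by at least c a_k per step, since (1/r + c a)(r - c a r^2) = 1 - (c
    a r)^2 <= 1. *)
Lemma quadratic_recurrence r a c K : 0 <= c ->
  (forall k, 0 <= a k) ->
  (forall k, (k <= K)%N -> 0 < r k) ->
  (forall k, (k < K)%N -> r k.+1 <= r k - c * a k * r k ^+ 2) ->
  c * \sum_(k < K) a k <= (r K)^-1.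
Proof.
move=> c0 a0; elim: K => [r0 _|K IH r0 rS].
  by rewrite big_ord0 mulr0 invr_ge0 ltW // r0.
have {}IH := IH (fun k kK => r0 k (leqW kK)) (fun k kK => rS k (leqW kK)).
rewrite big_ord_recr /= mulrDr.
apply: (@le_trans _ _ ((r K)^-1 + c * a K)); first by rewrite lerD2r.
have rK := r0 K (leqnSn K); have rK1 := r0 K.+1 (leqnn _).
have ca : 0 <= c * a K by rewrite mulr_ge0.
rewrite -[leRHS]mul1r ler_pdivlMr //.
apply: (@le_trans _ _ (((r K)^-1 + c * a K) * (r K - c * a K * r K ^+ 2))).
  by rewrite ler_wpM2l ?rS // addr_ge0 // invr_ge0 ltW.
have -> : ((r K)^-1 + c * a K) * (r K - c * a K * r K ^+ 2) =
   1 - (c * a K * r K) ^+ 2 by field; rewrite gt_eqF.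
by rewrite gerBl sqr_ge0.
Qed.

End recurrences.

(** * Consequences of the assumptions; finiteness and attainment of gamma *)

Section osgm.
Context {R : realType} {n : nat}.
Variables (f : 'cV[R]_n -> R) (PP : set 'M[R]_n) (L mu D : R).
Variables (x1 : 'cV[R]_n) (P1 : 'M[R]_n) (M : 'M[R]_n -> 'cV[R]_n -> 'cV[R]_n).
Hypothesis inst : osgm_instance f PP L mu D x1 P1 M.
Implicit Types (x z : 'cV[R]_n) (P Q : 'M[R]_n).
Notation g := (gradient f).
Notation gamma := (gamma_star f PP x1).

Let L0 : 0 < L. Proof. exact: (inst_L inst). Qed.
Let D0 : 0 < D. Proof. exact: (inst_D inst). Qed.
Let fL : smooth L f. Proof. exact: (inst_smooth inst). Qed.

Lemma bregman_ge0 x z : 0 <= bregman f x z.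
Proof.
apply: le_trans (inst_convex inst x z).
by rewrite mulr_ge0 ?sqr_ge0 // divr_ge0 // (inst_mu inst).
Qed.

Lemma instance_continuous : continuous f.
Proof. by move=> x; apply/differentiable_continuous/(inst_diff inst).1. Qed.

Lemma diam_bound P Q : PP P -> PP Q -> mdot (P - Q) (P - Q) <= D ^+ 2.
Proof.
move=> PP_P PP_Q; rewrite -fnorm_sqr ler_sqr ?nnegrE ?sqrtr_ge0 ?(ltW D0) //.
rewrite -lee_fin; apply: le_trans (inst_diam inst).
by apply: ereal_sup_ubound; exists (P, Q).
Qed.

Lemma norm_bound P : PP P -> mdot P P <= D ^+ 2.
Proof. by move=> /diam_bound/(_ (inst_PP0 inst)); rewrite subr0. Qed.

Lemma instance_compact : compact PP.
Proof. exact: bounded_closed_compact_mx norm_bound (inst_closed inst). Qed.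

Let PPn0 : PP !=set0. Proof. by exists 0; exact: (inst_PP0 inst). Qed.

Lemma gap_gt0 x z : ~ minimizers f x -> minimizers f z -> 0 < f x - f z.
Proof.
move=> xmin zmin; rewrite subr_gt0 ltNge; apply/negP => xz.
by apply: xmin => y; exact: le_trans xz (zmin y).
Qed.

Lemma worst_decrease_le x P : f x <= f x1 -> ~ minimizers f x ->
  (worst_decrease f x1 P <= (- surrogate f x P)%:E)%E.
Proof. by move=> xs xm; apply: ereal_inf_lbound; exists x. Qed.

(* Plain 1/L gradient descent certifies the lower bound 1 / (2 L). *)
Lemma worst_decrease_sup :
  ereal_sup [set worst_decrease f x1 P | P in PP] = gamma%:E /\ 0 < gamma.
Proof.
rewrite /gamma_star; set s := ereal_sup _.
have lo : (((2 * L)^-1)%:E <= s)%E.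
  apply: (@le_trans _ _ (worst_decrease f x1 (L^-1)%:M)); last first.
    by apply: ereal_sup_ubound; exists (L^-1)%:M => //; exact: (inst_PPL inst).
  apply: le_ereal_inf_tmp => _ [x [_ xm] <-]; rewrite lee_fin lerNr.
  exact: (surrogate_scalar L0 fL bregman_ge0).
have [z zmin] := inst_min inst.
have N0 := gradient_neq0 bregman_ge0 (inst_x1 inst).
(* The infimum is at most its value at [x1], where no step can decrease [f] by more than the initial
   gap. With [lo] this makes [s] finite, so [fine] keeps its value. *)
have hi : (s <= ((f x1 - f z) / mdot (g x1) (g x1))%:E)%E.
  apply: ge_ereal_sup => _ [P _ <-].
  apply: le_trans (worst_decrease_le P (lexx _) (inst_x1 inst)) _.
  rewrite lee_fin surrogateE -mulNr ler_pM2r ?invr_gt0 //.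
  have := zmin (x1 - P *m g x1); lra.
have sfin : s \is a fin_num.
  by rewrite fin_numElt (lt_le_trans (ltNyr _) lo) (le_lt_trans hi (ltry _)).
split; first by rewrite fineK.
by rewrite -lte_fin fineK // (lt_le_trans _ lo) // lte_fin invr_gt0 mulr_gt0.
Qed.

Lemma gamma_gt0 : 0 < gamma. Proof. exact: worst_decrease_sup.2. Qed.

(* If no P reached gamma, each P would miss it by some e > 0 on a neighbourhood;
   compactness makes e uniform, contradicting the supremum. *)
Lemma gamma_attained : exists2 P, PP P &
  forall x, f x <= f x1 -> ~ minimizers f x -> surrogate f x P <= - gamma.
Proof.
apply: contrapT => noP.
have bad P : PP P -> exists x, [/\ f x <= f x1, ~ minimizers f x &
    - gamma < surrogate f x P].
  move=> PPP; apply: contrapT => nox; apply: noP; exists P => // x xs xm.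
  by rewrite leNgt; apply/negP => h; apply: nox; exists x.
have /compact_near_coveringP cov := instance_compact.
have := @cov R (0^'+) (fun e P => exists x, [/\ f x <= f x1, ~ minimizers f x &
    e - gamma <= surrogate f x P]) _.
have H P : PP P -> \forall Q \near P & e \near 0^'+,
    exists x, [/\ f x <= f x1, ~ minimizers f x & e - gamma <= surrogate f x Q].
  move=> /bad[x [xs xm lt_x]].
  (* Half the slack at [P]: the other half absorbs moving from [P] to a nearby [Q]. *)
  pose d := (surrogate f x P + gamma) / 2.
  have d0 : 0 < d by rewrite /d; lra.
  exists ([set Q | d - gamma < surrogate f x Q], [set e | e < d]); last first.
    move=> [Q e] [/= hQ he]; exists x; split => //; lra.
  split => /=; last exact: nbhs_right_lt.
  have h : d - gamma < surrogate f x P by rewrite /d; lra.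
  exact: (cvgr_gt _ (@continuous_surrogate _ _ f x instance_continuous P) _ h).
move=> /(_ _ H) near0.
have [e [e0 he]] : exists e : R, 0 < e /\ forall P, PP P -> exists x,
    [/\ f x <= f x1, ~ minimizers f x & e - gamma <= surrogate f x P].
  near (0 : R)^'+ => e; exists e; split; first by near: e; exact: nbhs_right_gt.
  by near: e.
have : (gamma%:E <= (gamma - e)%:E)%E.
  rewrite -worst_decrease_sup.1; apply: ge_ereal_sup => _ [P PPP <-].
  have [x [xs xm le_x]] := he P PPP.
  apply: le_trans (worst_decrease_le P xs xm) _; rewrite lee_fin; lra.
rewrite lee_fin; lra.
Unshelve. all: by end_near. Qed.

Lemma gamma_maximum :
  is_maximum [set worst_decrease f x1 P | P in PP] gamma%:E.
Proof.
have [sE _] := worst_decrease_sup.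
have ub : ubound [set worst_decrease f x1 P | P in PP] gamma%:E.
  by move=> y hy; rewrite -sE; exact: ereal_sup_ubound.
split=> //; have [P PPP hP] := gamma_attained; exists P => //.
apply/eqP; rewrite eq_le; apply/andP; split; first by apply: ub; exists P.
apply: le_ereal_inf_tmp => _ [x [xs xm] <-].
by rewrite lee_fin lerNr; exact: hP.
Qed.

(** * Analysis of a run: descent, regret and rates *)

Section run.
(* States are numbered from 0 here: [X k] is the iterate x^(k+1). *)
Variable K : nat.
Hypothesis K1 : (1 <= K)%N.
Notation eta := (osgm_eta L D K).
Notation st k := (iter k (osgm_step f PP M eta) (x1, P1)).
Notation X k := (st k).1.
Notation Pk k := (st k).2.

(** The clipping at 0 reflects that the oracle does at least as well as staying at the current
    point. *)
Definition progress k : R := Num.max 0 (- surrogate f (X k) (Pk k)).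

Lemma osgm_step_nonmin (s : 'cV[R]_n * 'M[R]_n) : ~ minimizers f s.1 ->
  osgm_step f PP M eta s =
  (M s.2 s.1, fproj PP (s.2 - eta *: surrogate_grad f s.1 s.2)).
Proof. by move=> h; rewrite /osgm_step memNset. Qed.

(** Staying in the sublevel set of [x1] is what makes the bound defining gamma available at every
    iterate. *)
Lemma osgm_invariant k : PP (Pk k) /\ f (X k) <= f x1.
Proof.
elim: k => [|k [PPk fk]]; first by split => //; exact: (inst_P1 inst).
rewrite !iterS; have [m|m] := pselect (minimizers f (X k)).
  by rewrite /osgm_step (mem_set m).
rewrite (osgm_step_nonmin m) /=; split.
  exact: (fproj_in instance_compact PPn0).
apply: le_trans fk; apply: le_trans (inst_oracle inst PPk (X k)) _.
by rewrite ge_min lexx.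
Qed.

Lemma osgm_descent k : ~ minimizers f (X k) ->
  f (X k.+1) <= f (X k) - progress k * mdot (g (X k)) (g (X k)).
Proof.
move=> m; rewrite iterS (osgm_step_nonmin m) /=.
apply: le_trans (inst_oracle inst (osgm_invariant k).1 (X k)) _.
have N0 := gradient_neq0 bregman_ge0 m.
rewrite /progress surrogateE; case: (leP 0) => _; last by rewrite mul0r subr0 ge_min lexx.
rewrite mulNr opprK divfK ?gt_eqF // ge_min; apply/orP; right; lra.
Qed.

(** One step of projected gradient descent: the projection does not increase the distance to [P],
    the expanded square has the subgradient inequality as cross term, and the gradient bound
    controls the rest. *)
Lemma regret_step k P : ~ minimizers f (X k) -> PP P -> 0 < eta ->
  2 * eta * (surrogate f (X k) (Pk k) - surrogate f (X k) P) <=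
  mdot (Pk k - P) (Pk k - P) - mdot (Pk k.+1 - P) (Pk k.+1 - P) +
  eta ^+ 2 * (2 * (1 + L ^+ 2 * D ^+ 2)).
Proof.
move=> m PPP eta0; rewrite iterS (osgm_step_nonmin m) /=.
set e := eta in eta0 *; set x := X k in m *; set Q := Pk k.
have PPQ : PP Q := (osgm_invariant k).1.
set G := surrogate_grad f x Q.
have := fproj_contract (inst_PP_convex inst) instance_compact PPn0 (Q - e *: G) PPP.
set B := fproj _ _ => h1.
have h2 : mdot G G <= 2 * (1 + L ^+ 2 * D ^+ 2).
  apply: le_trans (surrogate_grad_bound L0 fL bregman_ge0 Q m) _.
  rewrite ler_pM2l // lerD2l ler_wpM2l ?sqr_ge0 //; exact: norm_bound.
have h3 := surrogate_subgradient bregman_ge0 P Q m; rewrite -/G in h3.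
have {}h2 := ler_wpM2l (sqr_ge0 e) h2.
have {}h3 := ler_wpM2l (ltW eta0) h3.
have e1 : Q - e *: G - P = (Q - P) - e *: G by rewrite addrAC.
rewrite e1 in h1; have e2 : P - Q = - (Q - P) by rewrite opprB.
rewrite e2 in h3; clearbody G B.
move: (Q - P) h1 h3 => v; rewrite !mdotE (mdotC v G) => h1 h3.
lra.
Qed.

Lemma regret_bound : (forall k, (k < K)%N -> ~ minimizers f (X k)) ->
  K%:R * gamma - 3 * (D * (L * D + 1)) * Num.sqrt K%:R <=
  \sum_(k < K) progress k.
Proof.
move=> m; have [P PPP hP] := gamma_attained.
set q := Num.sqrt K%:R; set W := L * D + 1.
have q0 : 0 < q by rewrite sqrtr_gt0 ltr0n.
have LD0 : 0 < L * D by rewrite mulr_gt0.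
have W0 : 0 < W by rewrite /W; lra.
have etaE : eta = 2 * D / (W * q) by [].
have eta0 : 0 < eta by rewrite etaE divr_gt0 // mulr_gt0.
have step (k : 'I_K) : 2 * eta * (gamma - progress k) <=
    (- mdot (Pk k.+1 - P) (Pk k.+1 - P) - - mdot (Pk k - P) (Pk k - P)) +
    eta ^+ 2 * (2 * (1 + L ^+ 2 * D ^+ 2)).
  have mk := m k (ltn_ord k).
  have := regret_step mk PPP eta0.
  have h : gamma - progress k <= surrogate f (X k) (Pk k) - surrogate f (X k) P.
    have := hP _ (osgm_invariant k).2 mk.
    have : - surrogate f (X k) (Pk k) <= progress k by rewrite le_max lexx orbT.
    lra.
  have e20 : 0 <= 2 * eta by lra.
  have := ler_wpM2l e20 h; lra.
have := ler_sum (index_enum 'I_K) (fun k (_ : true) => step k).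
rewrite -mulr_sumr sumrB big_split /= sumr_const card_ord.
have -> : \sum_(k < K) (- mdot (Pk k.+1 - P) (Pk k.+1 - P) -
      - mdot (Pk k - P) (Pk k - P)) =
    mdot (P1 - P) (P1 - P) - mdot (Pk K - P) (Pk K - P).
  rewrite -(big_mkord xpredT (fun k => - mdot (Pk k.+1 - P) (Pk k.+1 - P) -
      - mdot (Pk k - P) (Pk k - P))).
  by rewrite (telescope_sumr (fun k => - mdot (Pk k - P) (Pk k - P))) //= opprK addrC.
rewrite sumr_const card_ord -(mulr_natl gamma) -(mulr_natl (eta ^+ 2 * _)).
set S := \sum_(k < K) _; have -> : K%:R = q ^+ 2 by rewrite sqr_sqrtr ?ler0n.
have := diam_bound (inst_P1 inst) PPP; have := mdot_ge0 (Pk K - P).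
move: (mdot _ _) (mdot _ _) => u v u0 vD h.
have {u u0 v vD h} : 2 * eta * (q ^+ 2 * gamma - S) <=
    D ^+ 2 + q ^+ 2 * (eta ^+ 2 * (2 * (1 + L ^+ 2 * D ^+ 2))) by lra.
(* Since 1 + (L D)^2 <= W^2 and q eta = 2 D / W, the right-hand side is at most D^2 + 8 D^2, below
   the 12 D^2 that the constant 3 in the claim provides. *)
have hW : 2 * (1 + L ^+ 2 * D ^+ 2) <= 2 * W ^+ 2.
  by rewrite /W; lra.
have {}hW := ler_wpM2l (sqr_ge0 (q * eta)) hW.
have qe : q * eta = 2 * D / W by rewrite etaE; field; rewrite !gt_eqF.
move=> h; rewrite -(ler_pM2l (_ : 0 < 2 * eta)); last by lra.
have e1 : (q * eta) ^+ 2 * 2 * W ^+ 2 = 8 * D ^+ 2.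
  by rewrite qe; field; rewrite gt_eqF.
have e2 : 2 * eta * (3 * (D * W) * q) = 12 * D ^+ 2.
  have -> : 2 * eta * (3 * (D * W) * q) = 6 * D * W * (q * eta) by ring.
  by rewrite qe; field; rewrite gt_eqF.
have := sqr_ge0 D; lra.
Qed.

(** The threshold on [K] says that sqrt K is at least 6 D (L D + 1) / gamma, so the regret term
    takes at most half of K gamma. *)
Lemma progress_sum : (forall k, (k < K)%N -> ~ minimizers f (X k)) ->
  (6 * (D * (L * D + 1)) / gamma) ^+ 2 <= K%:R ->
  K%:R * gamma / 2 <= \sum_(k < K) progress k.
Proof.
move=> /regret_bound; set c := D * _; set q := Num.sqrt _ => h.
have g0 := gamma_gt0.
have qK : K%:R = q ^+ 2 by rewrite sqr_sqrtr ?ler0n.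
have q0 : 0 <= q by rewrite sqrtr_ge0.
have c0 : 0 <= c.
  by rewrite mulr_ge0 ?(ltW D0) // addr_ge0 // mulr_ge0 ?(ltW D0) ?(ltW L0).
rewrite qK in h *; rewrite ler_sqr ?nnegrE //; last first.
  by rewrite divr_ge0 ?(ltW g0) // mulr_ge0.
rewrite ler_pdivrMr // => hq.
apply: le_trans h; have := ler_wpM2l q0 hq; lra.
Qed.

(** Compactness gives the minimum. The maximizer of gamma is a competitor for which every summand is
    at most [- gamma]. *)
Lemma theta_bound : (forall k, (k < K)%N -> ~ minimizers f (X k)) ->
  exists theta : R,
    is_minimum [set K%:R^-1 * \sum_(k < K) surrogate f (X k) P | P in PP] theta /\
    theta <= - gamma.
Proof.
move=> m.
have c : continuous (fun P => K%:R^-1 * \sum_(k < K) surrogate f (X k) P).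
  move=> P; apply: (@continuousM R 'M[R]_n (cst _)
    (fun P => \sum_(k < K) surrogate f (X k) P)); first exact: cst_continuous.
  apply: continuous_sum => k.
  exact: (@continuous_surrogate _ _ f (X k) instance_continuous).
have [P PPP Pmin] := compact_argmin PPn0 instance_compact c.
exists (K%:R^-1 * \sum_(k < K) surrogate f (X k) P); split.
  by split; [exists P | move=> _ [Q PPQ <-]; exact: Pmin].
have [Q PPQ hQ] := gamma_attained; apply: le_trans (Pmin Q PPQ) _.
rewrite mulrC ler_pdivrMr ?ltr0n //.
apply: (@le_trans _ _ (\sum_(k < K) - gamma)).
  by apply: ler_sum => k _; apply: hQ; [exact: (osgm_invariant k).2 | exact: m].
by rewrite sumr_const card_ord mulr_natr.
Qed.

(** Polyak-Lojasiewicz feeds the linear recurrence with c = 2 mu; the factor 2 cancels the half in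
    [progress_sum]. *)
Lemma strongly_convex_gap z : 0 < mu -> minimizers f z ->
  (forall k, (k <= K)%N -> ~ minimizers f (X k)) ->
  (6 * (D * (L * D + 1)) / gamma) ^+ 2 <= K%:R ->
  f (X K) - f z <= (f x1 - f z) * expR (- (mu * gamma * K%:R)).
Proof.
move=> mu0 zmin m KK.
have := @linear_recurrence R (fun k => f (X k) - f z) progress (2 * mu) K.
move=> H; apply: le_trans (H _ _) _ => {H}.
- by move=> k _; rewrite subr_ge0 zmin.
- move=> k kK; have := osgm_descent (m k (ltnW kK)).
  have p0 : 0 <= progress k by rewrite le_max lexx.
  have := ler_wpM2l p0 (polyak_lojasiewicz (X k) z mu0 (inst_convex inst)).
  lra.
- rewrite ler_wpM2l //; first by rewrite subr_ge0 zmin.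
  rewrite ler_expR lerN2.
  have := ler_wpM2l (ltW mu0) (progress_sum (fun k kK => m k (ltnW kK)) KK); lra.
Qed.

Lemma Delta_gap x z : (Delta f x1 < +oo)%E -> f x <= f x1 ->
  ~ minimizers f x -> minimizers f z ->
  0 < fine (Delta f x1) /\
  (f x - f z) ^+ 2 <= mdot (g x) (g x) * fine (Delta f x1) ^+ 2.
Proof.
move=> Dfin xs xm zmin; have N0 := gradient_neq0 bregman_ge0 xm.
set N := mdot _ _ in N0 *; have gap0 := gap_gt0 xm zmin.
(* By [convex_gap], [r] is a lower bound for the distance from [x] to every minimizer, so it is at
   most [Delta]; this also gives [Delta] its positivity. *)
set r := (f x - f z) / Num.sqrt N.
have sN : 0 < Num.sqrt N by rewrite sqrtr_gt0.
have r0 : 0 < r by rewrite divr_gt0.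
have rD : (r%:E <= Delta f x1)%E.
  apply: (@le_trans _ _ (ereal_inf [set (enorm (x - y))%:E | y in minimizers f])).
    apply: le_ereal_inf_tmp => _ [y ymin <-]; rewrite lee_fin ler_pdivrMr //.
    have -> : f z = f y by apply/eqP; rewrite eq_le zmin ymin.
    rewrite -ler_sqr ?nnegrE ?subr_ge0 ?mulr_ge0 ?sqrtr_ge0 //.
    by rewrite exprMn enorm_sqr sqr_sqrtr ?(ltW N0) // mulrC convex_gap //; exact: bregman_ge0.
  by apply: ereal_sup_ubound; exists x.
have fin : Delta f x1 \is a fin_num.
  by rewrite fin_numElt Dfin andbT (lt_le_trans (ltNyr _) rD).
have {}rD : r <= fine (Delta f x1) by rewrite -lee_fin fineK.
split; first exact: lt_le_trans rD.
rewrite ler_pdivrMr // in rD.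
rewrite -{1}(sqr_sqrtr (ltW N0)) -exprMn mulrC ler_sqr ?nnegrE //.
- exact: ltW.
- by rewrite (le_trans _ rD) // ltW.
Qed.

Lemma convex_gap_rate z : (Delta f x1 < +oo)%E -> minimizers f z ->
  (forall k, (k <= K)%N -> ~ minimizers f (X k)) ->
  (6 * (D * (L * D + 1)) / gamma) ^+ 2 <= K%:R ->
  (f (X K) - f z) * (K%:R * gamma) <= 2 * fine (Delta f x1) ^+ 2.
Proof.
move=> Dfin zmin m KK; set d := fine _.
have [d0 _] := Delta_gap Dfin (lexx _) (inst_x1 inst) zmin; rewrite -/d in d0.
have d2 : 0 < d ^+ 2 by rewrite exprn_gt0.
have c0 : 0 <= (d ^+ 2)^-1 by rewrite invr_ge0 ltW.
have p0 k : 0 <= progress k by rewrite le_max lexx.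
have rK : 0 < f (X K) - f z by rewrite gap_gt0 //; exact: m.
have := @quadratic_recurrence R (fun k => f (X k) - f z) progress _ K c0 p0.
move=> H; have {H} : (d ^+ 2)^-1 * \sum_(k < K) progress k <= (f (X K) - f z)^-1.
  apply: H => k kK; first by rewrite gap_gt0 //; exact: m.
  have mk := m k (ltnW kK).
  have := osgm_descent mk.
  have [_ h] := Delta_gap Dfin (osgm_invariant k).2 mk zmin; rewrite -/d in h.
  rewrite -ler_pdivrMr // in h; have := ler_wpM2l (p0 k) h; lra.
have := ler_wpM2l c0 (progress_sum (fun k kK => m k (ltnW kK)) KK).
move=> h1 h2; have {h1 h2} := le_trans h1 h2.
rewrite -[leRHS]mul1r ler_pdivlMr // -(mulrA (d ^+ 2)^-1) (mulrC (d ^+ 2)^-1) ler_pdivrMr //.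
lra.
Qed.

End run.
End osgm.

(** * Complexity bounds: choice of constants and accuracy thresholds *)

Theorem corollary6p1 (R : realType) :
  (forall (n : nat) (f : 'cV[R]_n -> R) (PP : set 'M[R]_n) (L mu D : R)
      (x1 : 'cV[R]_n) (P1 : 'M[R]_n) (M : 'M[R]_n -> 'cV[R]_n -> 'cV[R]_n),
    osgm_instance f PP L mu D x1 P1 M ->
    is_maximum [set worst_decrease f x1 P | P in PP] (gamma_star f PP x1)%:E /\
    (forall K : nat, (1 <= K)%N ->
      (forall k : nat, (1 <= k <= K)%N ->
        ~ minimizers f (osgm_x f PP L D x1 P1 M K k)) ->
      exists theta : R,
        is_minimum
          [set K%:R^-1 *
               \sum_(1 <= k < K.+1) surrogate f (osgm_x f PP L D x1 P1 M K k) P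
          | P in PP] theta /\
        theta <= - gamma_star f PP x1)) /\
  (exists C : R, 0 < C /\
    forall (n : nat) (f : 'cV[R]_n -> R) (PP : set 'M[R]_n) (L mu D : R)
      (x1 : 'cV[R]_n) (P1 : 'M[R]_n) (M : 'M[R]_n -> 'cV[R]_n -> 'cV[R]_n),
    osgm_instance f PP L mu D x1 P1 M ->
    0 < mu ->
    exists eps0 : R, 0 < eps0 < 1 /\
    forall eps : R, 0 < eps < eps0 ->
    forall K : nat, (1 <= K)%N ->
      C / (2 * mu * gamma_star f PP x1) * ln (1 / eps) <= K%:R ->
      exists k : nat, (1 <= k <= K.+1)%N /\
        forall xstar, minimizers f xstar ->
          f (osgm_x f PP L D x1 P1 M K k) <= f xstar + eps) /\
  (exists C : R -> R, (forall delta : R, 0 < C delta) /\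
    forall (n : nat) (f : 'cV[R]_n -> R) (PP : set 'M[R]_n) (L mu D : R)
      (x1 : 'cV[R]_n) (P1 : 'M[R]_n) (M : 'M[R]_n -> 'cV[R]_n -> 'cV[R]_n),
    osgm_instance f PP L mu D x1 P1 M ->
    mu = 0 ->
    (Delta f x1 < +oo)%E ->
    exists eps0 : R, 0 < eps0 < 1 /\
    forall eps : R, 0 < eps < eps0 ->
    forall K : nat, (1 <= K)%N ->
      C (fine (Delta f x1)) / (gamma_star f PP x1 * eps) <= K%:R ->
      exists k : nat, (1 <= k <= K.+1)%N /\
        forall xstar, minimizers f xstar ->
          f (osgm_x f PP L D x1 P1 M K k) <= f xstar + eps).
Proof.
split; [|split].
- move=> n f PP L mu D x1 P1 M inst; split; first exact: gamma_maximum inst.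
  (* The sum is shifted to start at 0: iterate number [k.+1] is the state after [k] steps. *)
  move=> K K1 m; rewrite (_ : (fun P => _) = fun P => K%:R^-1 *
      \sum_(k < K) surrogate f (osgm_x f PP L D x1 P1 M K k.+1) P); last first.
    by apply/funext => P; rewrite big_add1 /= big_mkord.
  by apply: (theta_bound inst K1) => k kK; exact: (m k.+1).
(* With 4 the bound on [K] gives exp(- mu gamma K) <= eps^2; one factor eps absorbs the initial
   gap. *)
- exists 4; split=> // n f PP L mu D x1 P1 M inst mu0.
  have [z zmin] := inst_min inst; have g0 := gamma_gt0 inst.
  set gam := gamma_star f PP x1 in g0 *.
  pose K0 := (6 * (D * (L * D + 1)) / gam) ^+ 2.
  pose r := f x1 - f z; have r0 : 0 < r := gap_gt0 (inst_x1 inst) zmin.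
  have mg0 : 0 < mu * gam by rewrite mulr_gt0.
  (* The first entry keeps the threshold below 1, the second gives r eps <= 1, and the third forces
     [K] past [K0]. *)
  exists (Num.min 2^-1 (Num.min r^-1 (expR (- (mu * gam * K0 / 2))))); split.
    apply/andP; split; first by rewrite !lt_min !invr_gt0 r0 expR_gt0 ltr0n.
    by rewrite gt_min; apply/orP; left; lra.
  move=> e /andP[e0]; rewrite !lt_min => /and3P[_ er eK] K K1.
  rewrite div1r lnV ?posrE // => hK.
  have {}hK : 2 * - ln e <= mu * gam * K%:R.
    have := ler_wpM2l (ltW mg0) hK.
    suff -> : mu * gam * (4 / (2 * mu * gam) * - ln e) = 2 * - ln e by [].
    by field; rewrite !gt_eqF.
  have KK0 : K0 <= K%:R.
    rewrite -(ler_pM2l mg0); apply: le_trans hK.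
    have : ln e <= - (mu * gam * K0 / 2).
      by rewrite -[leRHS]expRK ler_ln ?posrE ?expR_gt0 // ltW.
    lra.
  (* Either the run hits a minimizer, which is the required iterate, or the rate applies to the last
     iterate. *)
  have [[k [kK mk]]|nomin] := pselect (exists k, (k <= K)%N /\
      minimizers f (osgm_x f PP L D x1 P1 M K k.+1)).
    by exists k.+1; split=> // y _; rewrite (le_trans (mk y)) // lerDl ltW.
  exists K.+1; split; first by rewrite leqnn.
  move=> y ymin; have {ymin} yz : f z <= f y by exact: zmin.
  have nm k : (k <= K)%N -> ~ minimizers f (osgm_x f PP L D x1 P1 M K k.+1).
    by move=> kK mk; apply: nomin; exists k.
  have := strongly_convex_gap inst K1 mu0 zmin nm KK0; rewrite -/r -/gam => h.
  suff : r * expR (- (mu * gam * K%:R)) <= e by rewrite /osgm_x /=; lra.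
  have h2 : expR (- (mu * gam * K%:R)) <= e ^+ 2.
    have {1}-> : e = expR (ln e) by rewrite lnK ?posrE.
    by rewrite -expRM_natl ler_expR; lra.
  apply: le_trans (ler_wpM2l (ltW r0) h2) _.
  rewrite expr2 mulrA -[leRHS]mul1r ler_pM2r // -ler_pdivlMl // mulr1.
  exact: ltW.
(* The term 2 d^2 matches the rate; the added 1 gives K gamma eps >= 1, which with eps below 1 /
   (gamma K0) forces [K] past [K0]. *)
- exists (fun d => 2 * d ^+ 2 + 1); split.
    by move=> d; rewrite ltr_wpDl // mulr_ge0 // sqr_ge0.
  move=> n f PP L mu D x1 P1 M inst _ Dfin.
  have [z zmin] := inst_min inst; have g0 := gamma_gt0 inst.
  set gam := gamma_star f PP x1 in g0 *; set d := fine _.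
  pose K0 := (6 * (D * (L * D + 1)) / gam) ^+ 2 + 1.
  have K00 : 0 < K0 by rewrite ltr_wpDl // sqr_ge0.
  exists (Num.min 2^-1 (gam * K0)^-1); split.
    apply/andP; split; first by rewrite lt_min !invr_gt0 ltr0n mulr_gt0.
    by rewrite gt_min; apply/orP; left; lra.
  move=> e /andP[e0]; rewrite lt_min => /andP[_ eK] K K1.
  rewrite ler_pdivrMr ?mulr_gt0 // => hK.
  have KK0 : (6 * (D * (L * D + 1)) / gam) ^+ 2 <= K%:R.
    have : K0 <= K%:R; last by rewrite /K0; lra.
    have h : K0 * (gam * e) <= 1.
      by rewrite mulrCA mulrA mulrC -ler_pdivlMr ?mulr_gt0 // div1r ltW.
    rewrite -(ler_pM2r (_ : 0 < gam * e)) ?mulr_gt0 //.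
    by apply: le_trans h _; apply: le_trans hK; rewrite lerDr mulr_ge0 // sqr_ge0.
  have [[k [kK mk]]|nomin] := pselect (exists k, (k <= K)%N /\
      minimizers f (osgm_x f PP L D x1 P1 M K k.+1)).
    by exists k.+1; split=> // y _; rewrite (le_trans (mk y)) // lerDl ltW.
  exists K.+1; split; first by rewrite leqnn.
  move=> y ymin; have {ymin} yz : f z <= f y by exact: zmin.
  have nm k : (k <= K)%N -> ~ minimizers f (osgm_x f PP L D x1 P1 M K k.+1).
    by move=> kK mk; apply: nomin; exists k.
  have := convex_gap_rate inst K1 Dfin zmin nm KK0; rewrite -/d -/gam => h.
  suff : f (osgm_x f PP L D x1 P1 M K K.+1) - f z <= e by lra.
  have Kg : 0 < K%:R * gam by rewrite mulr_gt0 // ltr0n.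
  rewrite -(ler_pM2r Kg); apply: le_trans h _; lra.
Qed.
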